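(* The inequalities $$\sum_{j \in N\setminus\{i\}} d_{ij}x_{ij} \le \alpha z \quad \forall i \in N, \qquad\qquad y_i + x_{ij} \le 1 \quad \forall i,j\in N,\ i\neq j$$ are valid inequalities for the formulation (APC1) of the discrete $\alpha$-neighbor $p$-center problem, i.e., when adding these inequalities to (APC1), the set of feasible solutions does not change.
   Context: Discrete $\alpha$-neighbor $p$-center problem (d-$\alpha$-$p$CP): given are a finite set of points $N$, a positive integer $p<|N|$, a positive integer $\alpha\le p$, and distances $d_{ij}\ge 0$ for $i,j\in N$. A feasible solution is a set $P\subseteq N$ with $|P|=p$ (open facilities). For $i\in N\setminus P$ let $d_\alpha(P,i)=\min_{A\subseteq P,|A|=\alpha}\max_{j\in A} d_{ij}$, and let $f_\alpha(P)=\max_{i\in N\setminus P} d_\alpha(P,i)$ be the objective function value of $P$. The problem is $\min_{P\subseteq N,|P|=p} f_\alpha(P)$. Formulation (APC1), in variables $y_j$ ($j\in N$), $x_{ij}$ ($i,j\in N$, $i\ne j$), $z$: minimize $z$ subject to - $\sum_{j\in N} y_j = p$; - $\sum_{j\in N\setminus\{i\}} x_{ij}=\alpha(1-y_i)$ for all $i\in N$; - $x_{ij}\le y_j$ for all $i,j\in N$, $i\ne j$; - $d_{ij}x_{ij}\le z$ for all $i,j\in N$, $i\neq j$; - $x_{ij}\in\{0,1\}$ for all $i,j\in N$, $i\ne j$; $y_j\in\{0,1\}$ for all $j\in N$; $z\in\mathbb{R}$. *)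

(* Defs.v *)
From mathcomp Require Import all_boot all_order all_algebra.
From mathcomp Require Import classical_sets reals.

Set Implicit Arguments.
Unset Strict Implicit.
Unset Printing Implicit Defensive.

Import Order.TTheory GRing.Theory Num.Theory.
Local Open Scope classical_set_scope.
Local Open Scope ring_scope.

(* The formulation has no variable x_ii: [xvar v i i] is a dummy coordinate,
   which no constraint or inequality below mentions. *)
Record apc1_vars (R : realType) (N : finType) := Apc1Vars {
  xvar : N -> N -> R;
  yvar : N -> R;
  zvar : R
}.

(* The feasible set of (APC1); its objective is to minimize [zvar]. *)
Definition apc1_feasible (R : realType) (N : finType) (p alpha : nat)
    (d : N -> N -> R) : set (apc1_vars R N) :=
  [set v | let x := xvar v in let y := yvar v in let z := zvar v in
    [/\ \sum_(j : N) y j = p%:R,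
        forall i : N, \sum_(j : N | j != i) x i j = alpha%:R * (1 - y i),
        forall i j : N, i != j -> x i j <= y j,
        forall i j : N, i != j -> d i j * x i j <= z &
        (forall i j : N, i != j -> x i j = 0 \/ x i j = 1) /\
        (forall j : N, y j = 0 \/ y j = 1)]].

Definition sum_ineqs (R : realType) (N : finType) (alpha : nat)
    (d : N -> N -> R) : set (apc1_vars R N) :=
  [set v | forall i : N,
    \sum_(j : N | j != i) d i j * xvar v i j <= alpha%:R * zvar v].

Definition conflict_ineqs (R : realType) (N : finType) : set (apc1_vars R N) :=
  [set v | forall i j : N, i != j -> yvar v i + xvar v i j <= 1].

(* Main.v *)
Require Import Defs.
From mathcomp Require Import all_boot all_order all_algebra.
From mathcomp Require Import classical_sets reals.

(** Both families are implied by the constraints of (APC1), so intersecting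
    with them does not shrink the feasible set.

    A binary [x i j] satisfies [x i j ^+ 2 = x i j], so the bottleneck
    constraint [d i j * x i j <= z] sharpens to [d i j * x i j <= z * x i j].
    Summing over [j] and using the assignment constraint bounds the weighted
    sum by [alpha * (1 - y i) * z], which is at most [alpha * z] because
    [0 <= z] ([apc1_sum_ineqs]).

    If [y i = 1], the assignment constraint makes the nonnegative numbers
    [x i j] sum to zero, so they all vanish; if [y i = 0], the conflict
    inequality is the bound [x i j <= 1] ([apc1_conflict_ineqs]). *)

Set Implicit Arguments.
Unset Strict Implicit.
Unset Printing Implicit Defensive.

Import Order.TTheory GRing.Theory Num.Theory.
Local Open Scope classical_set_scope.
Local Open Scope ring_scope.

Lemma binary_ge0 (R : numDomainType) (a : R) : a = 0 \/ a = 1 -> 0 <= a.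
Proof. by case=> ->. Qed.

(** The bottleneck constraints bound [z] below only through pairs of distinct
    points, so with a single point [z] could be negative. *)
Lemma apc1_z_ge0 (R : realType) (N : finType) (p alpha : nat)
    (d : N -> N -> R) (v : apc1_vars R N) :
  (1 < #|N|)%N -> (forall i j, 0 <= d i j) ->
  apc1_feasible p alpha d v -> 0 <= zvar v.
Proof.
move=> /card_gt1P[i [j [_ _ ij]]] d_ge0 [_ _ _ dx_le_z [x01 _]].
apply: le_trans (dx_le_z i j ij).
by rewrite mulr_ge0 // binary_ge0 //; apply: x01.
Qed.

Lemma apc1_sum_ineqs (R : realType) (N : finType) (p alpha : nat)
    (d : N -> N -> R) :
  (1 < #|N|)%N -> (forall i j, 0 <= d i j) ->
  apc1_feasible p alpha d `<=` sum_ineqs alpha d.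
Proof.
move=> N_gt1 d_ge0 v feas_v i.
have z_ge0 := apc1_z_ge0 N_gt1 d_ge0 feas_v.
have [_ sum_x _ dx_le_z [x01 y01]] := feas_v.
have dx_le_zx j : j != i -> d i j * xvar v i j <= zvar v * xvar v i j.
  rewrite eq_sym => ij; have := dx_le_z i j ij.
  by case: (x01 i j ij) => ->; rewrite ?mulr0 ?mulr1.
apply: le_trans (ler_sum _ dx_le_zx) _.
rewrite -mulr_sumr sum_x mulrC ler_wpM2r //.
by rewrite ler_piMr // gerBl binary_ge0.
Qed.

Lemma apc1_conflict_ineqs (R : realType) (N : finType) (p alpha : nat)
    (d : N -> N -> R) :
  apc1_feasible p alpha d `<=` @conflict_ineqs R N.
Proof.
move=> v [_ sum_x _ _ [x01 y01]] i j ij.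
have [yi0|yi1] := y01 i.
  by rewrite yi0 add0r; case: (x01 i j ij) => ->.
have x_ge0 k : k != i -> 0 <= xvar v i k.
  by rewrite eq_sym => ik; apply/binary_ge0/x01.
have sum_x0 : \sum_(k | k != i) xvar v i k = 0.
  by rewrite sum_x yi1 subrr mulr0.
by rewrite yi1 (psumr_eq0P x_ge0 sum_x0) ?addr0 // eq_sym.
Qed.

Theorem theorem1 (R : realType) (N : finType) (p alpha : nat)
    (d : N -> N -> R)
    (p_gt0 : (0 < p)%N) (p_lt_N : (p < #|N|)%N)
    (alpha_gt0 : (0 < alpha)%N) (alpha_le_p : (alpha <= p)%N)
    (d_ge0 : forall i j : N, 0 <= d i j) :
  apc1_feasible p alpha d `&` sum_ineqs alpha d `&` @conflict_ineqs R N
    = apc1_feasible p alpha d.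
Proof.
have N_gt1 : (1 < #|N|)%N by apply: leq_ltn_trans p_lt_N.
rewrite -setIA; apply: setIidl => v feas_v; split.
- exact: apc1_sum_ineqs N_gt1 d_ge0 _ feas_v.
- exact: apc1_conflict_ineqs feas_v.
Qed.
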